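(* Let $k$ be an arbitrary field and $S=k[x,y,z]$. Then the ideal $$I=(yz-x^6,\ x^7,\ x^4y,\ x^2y^2,\ x^3z,\ y^3,\ z^2)\subseteq S$$ is normal.
   Context: An ideal $I$ is normal if $I^s$ is integrally closed (equal to its integral closure) for every integer $s\geq 1$. *)

(* Defs.v *)
From mathcomp Require Import all_boot all_order all_algebra.
From mathcomp Require Import mpoly.

Set Implicit Arguments.
Unset Strict Implicit.
Unset Printing Implicit Defensive.

Import GRing.Theory.
Local Open Scope ring_scope.

(* Ideals are Prop-valued predicates on the ring: membership need not be
   decidable, and the unit ideal is allowed (unlike in ring_quotient, whose
   idealr_closed describes proper ideals only). *)

Definition ideal_gen (R : comNzRingType) (G : R -> Prop) : R -> Prop :=
  fun r => exists (n : nat) (c g : 'I_n -> R),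
    (forall i, G (g i)) /\ r = \sum_(i < n) c i * g i.

Definition ideal_mul (R : comNzRingType) (I J : R -> Prop) : R -> Prop :=
  ideal_gen (fun r => exists a b : R, [/\ I a, J b & r = a * b]).

Definition ideal_pow (R : comNzRingType) (I : R -> Prop) (s : nat) : R -> Prop :=
  iter s (ideal_mul I) (fun _ => True).

Definition integral_closure (R : comNzRingType) (I : R -> Prop) : R -> Prop :=
  fun r => exists (n : nat) (a : nat -> R),
    [/\ (0 < n)%N,
        forall i : nat, (1 <= i <= n)%N -> ideal_pow I i (a i)
      & r ^+ n + \sum_(1 <= i < n.+1) a i * r ^+ (n - i) = 0].

Definition integrally_closed (R : comNzRingType) (I : R -> Prop) : Prop :=
  forall r : R, integral_closure I r <-> I r.

Definition normal_ideal (R : comNzRingType) (I : R -> Prop) : Prop :=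
  forall s : nat, (1 <= s)%N -> integrally_closed (ideal_pow I s).

(* Main.v *)
(** Write [w = y z - x^6]. Rewriting [y z] as [w + x^6] shows that the monomials
    [x^a y^b z^c w^d] with [b c = 0] span [S]. For weights [v(x) = p],
    [v(y) = q], [v(z) = 6 p - q], [v(w) = 6 p + e], let [v] be the order in [T]
    along [x |-> X T^p], [y |-> T^q], [z |-> (X^6 + W T^e) T^(6 p - q)] from [S]
    to [k[X][W][T]]; then [w |-> W T^(6 p + e)]. This is a valuation, and on a
    combination of normal monomials it is the minimum of their weights: among
    the terms of too small weight, one of least degree in [w] has a leading term
    which nothing can cancel. The three valuations with [(p, q, e) = (1, 2, 0)],
    [(1, 3, 0)], [(2, 5, 1)] take on [I] values at least 6, 6, 13, so an element
    integral over [I^s] is a combination of normal monomials of weights at least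
    [6 s], [6 s], [13 s]. Each such monomial lies in [I^s]; beyond the exponents
    of the generators this only uses
    [x^13 = (x^4 y) (x^3 z) - x^7 w], an element of [I^2]. *)

From HB Require Import structures.
Require Import Defs.
From mathcomp Require Import all_boot all_order all_algebra.
From mathcomp Require Import mpoly.
From mathcomp Require Import zify ring.

Set Implicit Arguments.
Unset Strict Implicit.
Unset Printing Implicit Defensive.

Import GRing.Theory.
Local Open Scope ring_scope.

(** * Generated ideals and their powers *)

Section Ideals.
Variable R : comNzRingType.
Implicit Types (G I J : R -> Prop) (a b r : R).

Definition is_ideal J : Prop :=
  [/\ J 0, forall a b, J a -> J b -> J (a + b) & forall a b, J b -> J (a * b)].

Lemma ideal_gen_is_ideal G : is_ideal (ideal_gen G).
Proof.
split.
- by exists 0, (fun=> 0), (fun=> 0); split; [case | rewrite big_ord0].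
- move=> _ _ [n1 [c1 [g1 [G1 ->]]]] [n2 [c2 [g2 [G2 ->]]]].
  pose pick (u1 : 'I_n1 -> R) (u2 : 'I_n2 -> R) i :=
    match split i with inl j => u1 j | inr j => u2 j end.
  exists (n1 + n2)%N, (pick c1 c2), (pick g1 g2); split=> [i|].
    by rewrite /pick; case: (split i).
  have pickl u1 u2 i : pick u1 u2 (lshift n2 i) = u1 i.
    by rewrite /pick -[lshift _ _]/(unsplit (inl i)) unsplitK.
  have pickr u1 u2 i : pick u1 u2 (rshift n1 i) = u2 i.
    by rewrite /pick -[rshift _ _]/(unsplit (inr i)) unsplitK.
  rewrite big_split_ord /=; congr (_ + _); apply: eq_bigr => i _.
    by rewrite !pickl.
  by rewrite !pickr.
- move=> a _ [n [c [g [Gg ->]]]]; exists n, (fun i => a * c i), g; split=> //.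
  by rewrite mulr_sumr; apply: eq_bigr => i _; rewrite mulrA.
Qed.

Lemma ideal_gen_mem G r : G r -> ideal_gen G r.
Proof.
by move=> Gr; exists 1%N, (fun=> 1), (fun=> r); rewrite big_ord1 mul1r.
Qed.

Lemma ideal_gen_min G J :
  is_ideal J -> (forall g, G g -> J g) -> forall r, ideal_gen G r -> J r.
Proof.
move=> [J0 JD JM] GJ _ [n [c [g [Gg ->]]]].
by apply: big_ind => // i _; apply/JM/GJ.
Qed.

Lemma ideal_pow_is_ideal I s : is_ideal (ideal_pow I s).
Proof. by case: s => [|s]; [split | apply: ideal_gen_is_ideal]. Qed.

Lemma ideal_powD I s t a b :
  ideal_pow I s a -> ideal_pow I t b -> ideal_pow I (s + t) (a * b).
Proof.
move=> Ia Ib; elim: s a Ia => [|s IHs] a Ia.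
  by have [_ _ IM] := ideal_pow_is_ideal I t; apply: IM.
have [P0 PD PM] := ideal_pow_is_ideal I (s.+1 + t).
(* [J] is the colon ideal of [ideal_pow I (s.+1 + t)] by [b]; only products of [I] with
   [ideal_pow I s] need checking. *)
apply: (ideal_gen_min (J := fun a => ideal_pow I (s.+1 + t) (a * b))) Ia.
  split=> [|u v Pu Pv|u v Pv]; first by rewrite mul0r.
  - by rewrite mulrDl; apply: PD.
  - by rewrite -mulrA; apply: PM.
move=> _ [u [v [Iu Iv ->]]]; apply: ideal_gen_mem.
by exists u, (v * b); rewrite mulrA; split=> //; apply: IHs.
Qed.

Lemma ideal_pow1 I a : I a -> ideal_pow I 1 a.
Proof. by move=> Ia; apply: ideal_gen_mem; exists a, 1; rewrite mulr1. Qed.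

Lemma ideal_powX I s a n : ideal_pow I s a -> ideal_pow I (s * n) (a ^+ n).
Proof.
move=> Ia; elim: n => [|n IHn]; first by rewrite muln0.
by rewrite mulnS exprS; apply: ideal_powD.
Qed.

Lemma integral_closure_sub I :
  is_ideal I -> forall r, I r -> integral_closure I r.
Proof.
move=> [_ _ IM] r Ir; exists 1%N, (fun=> - r); split=> // [i|].
  by case: i => [|[|i]] // _; apply: ideal_pow1; rewrite -mulN1r; apply: IM.
by rewrite big_nat1 subnn expr0 mulr1 expr1 subrr.
Qed.

End Ideals.

(** * Order of vanishing and integral dependence *)

Section XadicOrder.
Variables (S : comNzRingType) (R : idomainType).
Variable phi : {rmorphism S -> {poly R}}.

Definition Xdvd n : S -> Prop := fun r => exists q, phi r = q * 'X^n.

Lemma Xdvd_ideal n : is_ideal (Xdvd n).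
Proof.
split=> [|a b [u Eu] [v Ev]|a b [v Ev]].
- by exists 0; rewrite rmorph0 mul0r.
- by exists (u + v); rewrite rmorphD Eu Ev mulrDl.
- by exists (phi a * v); rewrite rmorphM Ev mulrA.
Qed.

Lemma XdvdM m n a b : Xdvd m a -> Xdvd n b -> Xdvd (m + n) (a * b).
Proof.
by move=> [u Eu] [v Ev]; exists (u * v); rewrite rmorphM Eu Ev exprD mulrACA.
Qed.

Lemma XdvdX n d a : Xdvd n a -> Xdvd (d * n) (a ^+ d).
Proof.
by move=> [u Eu]; exists (u ^+ d); rewrite rmorphXn Eu exprMn -exprM mulnC.
Qed.

Lemma Xdvd_pow (I : S -> Prop) n :
  (forall a, I a -> Xdvd n a) ->
  forall s a, ideal_pow I s a -> Xdvd (s * n) a.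
Proof.
move=> In; elim=> [|s IHs] a; first by exists (phi a); rewrite mulr1.
apply: ideal_gen_min => [|_ [u [v [Iu Iv ->]]]]; first exact: Xdvd_ideal.
by rewrite mulSn; apply: XdvdM; [apply: In | apply: IHs].
Qed.

Lemma Xdvd_le m n r : (m <= n)%N -> Xdvd n r -> Xdvd m r.
Proof.
by move=> mn [u Eu]; exists (u * 'X^(n - m)); rewrite Eu -mulrA -exprD subnK.
Qed.

(** The order of [r] is raised one step at a time. If it is at least [l < n], each term
    [a i * r ^+ (d - i)] has order at least [i * n + (d - i) * l > l * d], so [r ^+ d] has order
    above [l * d]. *)
Lemma Xdvd_integral (I : S -> Prop) n :
  (forall a, I a -> Xdvd n a) ->
  forall r, integral_closure I r -> Xdvd n r.
Proof.
move=> In r [d [a [d_gt0 Ia Er]]].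
suff: forall l, (l <= n)%N -> Xdvd l r by apply.
elim=> [|l IHl] ln; first by exists (phi r); rewrite mulr1.
have [g Eg] := IHl (ltnW ln).
have [V0 VD VM] := Xdvd_ideal (l * d).+1.
have [h Eh] : Xdvd (l * d).+1 (r ^+ d).
  move/eqP: Er; rewrite addr_eq0 => /eqP ->; rewrite -mulN1r; apply: (VM).
  rewrite big_nat_cond; apply: big_ind => [||i]; [exact: V0 | exact: VD |].
  rewrite andbT => /andP[i_gt0 id].
  have Xa : Xdvd (i * n) (a i).
    by apply: Xdvd_pow In _ _ (Ia i _); rewrite i_gt0.
  have Xr : Xdvd ((d - i) * l) (r ^+ (d - i)).
    by exists (g ^+ (d - i)); rewrite rmorphXn Eg exprMn -exprM mulnC.
  by apply: Xdvd_le (XdvdM Xa Xr); nia.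
have: g ^+ d = h * 'X.
  have Xn0 : 'X^(l * d) != 0 :> {poly R} by rewrite monic_neq0 // monicXn.
  apply: (mulIf Xn0).
  by rewrite -mulrA -exprS -Eh rmorphXn Eg exprMn exprM.
(* The constant term of [g] has zero [d]-th power, hence vanishes because [R] is a domain; so ['X]
   divides [g]. *)
move/(congr1 (fun p => p.[0])); rewrite horner_exp hornerMX mulr0 => /eqP.
rewrite expf_eq0 d_gt0 /= => /factor_theorem[u Eu].
by exists u; rewrite Eg Eu subr0 -mulrA -exprS.
Qed.

End XadicOrder.

(** * Monomials in the powers of [I] *)

Section Monomials.
Variables (R : comNzRingType) (x y z : R).

Let gens := [:: y * z - x ^+ 6; x ^+ 7; x ^+ 4 * y; x ^+ 2 * y ^+ 2;
                x ^+ 3 * z; y ^+ 3; z ^+ 2].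
Let I : R -> Prop := ideal_gen (fun g => g \in gens).

Lemma gens_mem g : g \in gens -> ideal_pow I 1 g.
Proof. by move=> g_in; apply/ideal_pow1/ideal_gen_mem. Qed.

Lemma gens_mul g t r :
  g \in gens -> ideal_pow I t r -> ideal_pow I t.+1 (g * r).
Proof. by move=> /gens_mem Ig; apply: (ideal_powD Ig). Qed.

Lemma x13_mem : ideal_pow I 2 (x ^+ 13).
Proof.
have -> : x ^+ 13 = (x ^+ 4 * y) * (x ^+ 3 * z) +
                    (- 1) * ((y * z - x ^+ 6) * x ^+ 7) by ring.
have [_ ID IM] := ideal_pow_is_ideal I 2.
by apply: ID; [|apply: IM]; apply: gens_mul; rewrite ?inE ?eqxx ?orbT //;
   apply: gens_mem; rewrite ?inE ?eqxx ?orbT.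
Qed.

Lemma x_mem t a : (13 * t <= 2 * a)%N -> ideal_pow I t (x ^+ a).
Proof.
move=> ta; have [_ _ IM] := ideal_pow_is_ideal I t.
(* The least admissible exponent is 13 for each pair of factors, plus 7 for an unpaired one. *)
have -> : a = (a - (13 * t./2 + 7 * odd t) + (13 * t./2 + 7 * odd t))%N by lia.
rewrite exprD; apply: IM; rewrite exprD !exprM.
have {1}-> : t = (2 * t./2 + 1 * odd t)%N by lia.
by apply: ideal_powD; apply: ideal_powX; [exact: x13_mem |];
   apply: gens_mem; rewrite !inE eqxx orbT.
Qed.

(** Generators are split off one at a time, starting with [x^4 y], which has weights exactly 6 and
    13. *)
Lemma xy_mem t a b : (6 * t <= a + 2 * b)%N -> (13 * t <= 2 * a + 5 * b)%N ->
  ideal_pow I t (x ^+ a * y ^+ b).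
Proof.
elim: t a b => [|t IHt] a b Hab1 Hab2; first by [].
have [b0|b_gt0] := posnP b; first by rewrite b0 mulr1; apply: x_mem; lia.
have [a_ge4|a_lt4] := leqP 4 a.
  have -> : x ^+ a * y ^+ b = (x ^+ 4 * y) * (x ^+ (a - 4) * y ^+ (b - 1)).
    by rewrite -{1}(subnK a_ge4) -{1}(subnK b_gt0) !exprD; ring.
  by apply: gens_mul; rewrite ?inE ?eqxx ?orbT //; apply: IHt; lia.
(* [y^3] has weights 6 and 15; as [a < 4], the second inequality for the quotient follows from the
   first. *)
have [b_ge3|b_lt3] := leqP 3 b.
  have -> : x ^+ a * y ^+ b = y ^+ 3 * (x ^+ a * y ^+ (b - 3)).
    by rewrite -{1}(subnK b_ge3) !exprD; ring.
  by apply: gens_mul; rewrite ?inE ?eqxx ?orbT //; apply: IHt; lia.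
(* Now [a + 2 * b] is at most 7, which leaves room for one factor only; the second inequality
   excludes [b = 1] and [a < 2]. *)
have [b2 a_ge2 t0] : [/\ b = 2, 2 <= a & t = 0]%N by split; lia.
have -> : x ^+ a * y ^+ b = (x ^+ 2 * y ^+ 2) * x ^+ (a - 2).
  by rewrite b2 -{1}(subnK a_ge2) !exprD; ring.
by rewrite t0; apply: gens_mul; rewrite ?inE ?eqxx ?orbT.
Qed.

(** The same descent with [x^3 z], of weights 6 and 13, and [z^2], of weights 6 and 14; no third
    case arises because [a < 3] forces [c] to be at least 2. *)
Lemma xz_mem t a c : (6 * t <= a + 3 * c)%N -> (13 * t <= 2 * a + 7 * c)%N ->
  ideal_pow I t (x ^+ a * z ^+ c).
Proof.
elim: t a c => [|t IHt] a c Hac1 Hac2; first by [].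
have [c0|c_gt0] := posnP c; first by rewrite c0 mulr1; apply: x_mem; lia.
have [a_ge3|a_lt3] := leqP 3 a.
  have -> : x ^+ a * z ^+ c = (x ^+ 3 * z) * (x ^+ (a - 3) * z ^+ (c - 1)).
    by rewrite -{1}(subnK a_ge3) -{1}(subnK c_gt0) !exprD; ring.
  by apply: gens_mul; rewrite ?inE ?eqxx ?orbT //; apply: IHt; lia.
have c_ge2 : (2 <= c)%N by lia.
have -> : x ^+ a * z ^+ c = z ^+ 2 * (x ^+ a * z ^+ (c - 2)).
  by rewrite -{1}(subnK c_ge2) !exprD; ring.
by apply: gens_mul; rewrite ?inE ?eqxx ?orbT //; apply: IHt; lia.
Qed.

(** The generator [w] has weights 6, 6, 13, so [w^d] accounts for exactly [d] factors. The first and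
    third bounds settle [c = 0], the second and third [b = 0]. *)
Lemma normal_monomial_mem s a b c d : (b == 0)%N || (c == 0)%N ->
  (6 * s <= a + 2 * b + 4 * c + 6 * d)%N ->
  (6 * s <= a + 3 * b + 3 * c + 6 * d)%N ->
  (13 * s <= 2 * a + 5 * b + 7 * c + 13 * d)%N ->
  ideal_pow I s (x ^+ a * y ^+ b * z ^+ c * (y * z - x ^+ 6) ^+ d).
Proof.
move=> bc0 H1 H2 H3.
have Iw n : ideal_pow I n ((y * z - x ^+ 6) ^+ n).
  by rewrite -[X in ideal_pow I X]mul1n; apply/ideal_powX/gens_mem;
     rewrite inE eqxx.
have [s_le_d|d_lt_s] := leqP s d.
  have [_ _ IM] := ideal_pow_is_ideal I s.
  by rewrite -(subnK s_le_d) exprD mulrA; apply: IM.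
have {1}-> : s = (s - d + d)%N by lia.
apply: ideal_powD => //.
case/orP: bc0 => /eqP e0; rewrite e0 mulr1;
  [apply: xz_mem | apply: xy_mem]; lia.
Qed.

End Monomials.

(** * Weight valuations and leading terms *)

Section WeightHom.
Variables (k : fieldType) (p q e : nat).

Let x : {mpoly k[3]} := 'X_(@Ordinal 3 0 isT).
Let y : {mpoly k[3]} := 'X_(@Ordinal 3 1 isT).
Let z : {mpoly k[3]} := 'X_(@Ordinal 3 2 isT).

Let X : {poly {poly {poly k}}} := 'X%:P%:P.
Let W : {poly {poly {poly k}}} := 'X%:P.
Let T : {poly {poly {poly k}}} := 'X.

Definition weight_hom : {mpoly k[3]} -> {poly {poly {poly k}}} :=
  mmap (polyC \o polyC \o polyC)
    (fun i : 'I_3 => nth 0 [:: X * T ^+ p; T ^+ q;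
                               (X ^+ 6 + W * T ^+ e) * T ^+ (6 * p - q)] i).
HB.instance Definition _ := GRing.RMorphism.on weight_hom.

Lemma weight_homx : weight_hom x = X * T ^+ p.
Proof. by rewrite /weight_hom mmapX mmap1U. Qed.
Lemma weight_homy : weight_hom y = T ^+ q.
Proof. by rewrite /weight_hom mmapX mmap1U. Qed.
Lemma weight_homz : weight_hom z = (X ^+ 6 + W * T ^+ e) * T ^+ (6 * p - q).
Proof. by rewrite /weight_hom mmapX mmap1U. Qed.

Lemma weight_homw : (q <= 6 * p)%N ->
  weight_hom (y * z - x ^+ 6) = W * T ^+ (6 * p + e).
Proof.
move=> q_le.
rewrite rmorphB rmorphM rmorphXn /= weight_homx weight_homy weight_homz.
have TE : T ^+ q * T ^+ (6 * p - q) = T ^+ (6 * p) by rewrite -exprD subnKC.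
rewrite mulrCA TE exprMn -exprM mulnC exprD; ring.
Qed.

Definition weight a b c d :=
  (p * a + q * b + (6 * p - q) * c + (6 * p + e) * d)%N.

(** Modulo [W^(d+1)] only the [X^6] of [X^6 + W T^e] survives. For [e = 0] the remainder need not
    have higher order in [T], so it is the degree in [W] that separates it from the leading term. *)
Lemma weight_hom_monomial a b c d : (q <= 6 * p)%N -> exists Q,
  weight_hom (x ^+ a * y ^+ b * z ^+ c * (y * z - x ^+ 6) ^+ d) =
  (('X^(a + 6 * c) *: 'X^d : {poly {poly k}})%:P + ('X^(d.+1))%:P * Q) *
    'X^(weight a b c d).
Proof.
move=> q_le; set u := X ^+ 6; set v := W * T ^+ e.
(* The sum is the quotient of [(u + v)^c - u^c] by [v]; the [W] in [v] turns [W^d] into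
   [W^(d+1)]. *)
exists (X ^+ a * (T ^+ e * \sum_(i < c) (u + v) ^+ (c.-1 - i) * u ^+ i)).
have Euv : (u + v) ^+ c =
  u ^+ c + v * \sum_(i < c) (u + v) ^+ (c.-1 - i) * u ^+ i.
  by apply/eqP; rewrite [eqbRHS]addrC -subr_eq subrXX addrAC subrr add0r.
rewrite !(rmorphM, rmorphXn) /= weight_homw // weight_homx
  weight_homy weight_homz.
rewrite exprMn [(_ * T ^+ _) ^+ c]exprMn Euv [(W * _) ^+ d]exprMn.
have -> : ('X^(a + 6 * c) *: 'X^d : {poly {poly k}})%:P =
  X ^+ a * u ^+ c * W ^+ d :> {poly {poly {poly k}}}.
  by rewrite /u -exprM -exprD /X /W -mul_polyC polyCM !rmorphXn.
rewrite -/W [W ^+ d.+1]exprS.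
have -> : 'X^(weight a b c d) = (T ^+ p) ^+ a * (T ^+ q) ^+ b *
    (T ^+ (6 * p - q)) ^+ c * (T ^+ (6 * p + e)) ^+ d.
  by rewrite -!exprM -!exprD.
by rewrite /v; ring.
Qed.

End WeightHom.

(** The weight is [p (a + 6 c) + q (b - c) + (6 p + e) d], so the data fix [b - c], and [b c = 0]
    then fixes [b] and [c]. *)
Lemma weight_inj p q e a b c d a' b' c' d' :
  (0 < q <= 6 * p)%N -> d = d' ->
  (b == 0)%N || (c == 0)%N -> (b' == 0)%N || (c' == 0)%N ->
  (a + 6 * c = a' + 6 * c')%N ->
  weight p q e a b c d = weight p q e a' b' c' d' ->
  [/\ a = a', b = b' & c = c'].
Proof.
move=> /andP[q_gt0 q_le] -> bc bc' Ea; rewrite /weight => Ew.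
have Ep : (p * (a + 6 * c) = p * (a' + 6 * c'))%N by rewrite Ea.
have Er : (6 * p = q + (6 * p - q))%N by rewrite subnKC.
move: (6 * p - q)%N Er Ew => r Er Ew.
have : (q * (b + c') == q * (b' + c))%N by apply/eqP; nia.
rewrite eqn_pmul2l // => /eqP Ebc.
by split; lia.
Qed.

(** * Normal forms in [x, y, z, w] and their weights *)

Section NormalForm.
Variables (k : fieldType).

Let x : {mpoly k[3]} := 'X_(@Ordinal 3 0 isT).
Let y : {mpoly k[3]} := 'X_(@Ordinal 3 1 isT).
Let z : {mpoly k[3]} := 'X_(@Ordinal 3 2 isT).

Let i0 : 'I_4 := @Ordinal 4 0 isT.
Let i1 : 'I_4 := @Ordinal 4 1 isT.
Let i2 : 'I_4 := @Ordinal 4 2 isT.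
Let i3 : 'I_4 := @Ordinal 4 3 isT.

Definition eval_xyzw : {mpoly k[4]} -> {mpoly k[3]} :=
  mmap (@mpolyC 3 k) (fun i : 'I_4 => nth 0 [:: x; y; z; y * z - x ^+ 6] i).
HB.instance Definition _ := GRing.RMorphism.on eval_xyzw.

(** Unlike [normal_form] below, this condition is stable under products, so normality of an explicit
    product is checked through one missing variable. *)
Definition avoids n (i : 'I_n) (h : {mpoly k[n]}) :=
  forall m, m \in msupp h -> m i = 0%N.

Lemma avoidsD n (i : 'I_n) g h : avoids i g -> avoids i h -> avoids i (g + h).
Proof.
by move=> ig ih m /msuppD_le; rewrite mem_cat => /orP[/ig|/ih].
Qed.

Lemma avoidsM n (i : 'I_n) g h : avoids i g -> avoids i h -> avoids i (g * h).
Proof.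
move=> ig ih m /msuppM_le /allpairsP[[m1 m2] /= [/ig m1i /ih m2i ->]].
by rewrite mnmDE m1i m2i.
Qed.

Lemma avoidsX n (i : 'I_n) h l : avoids i h -> avoids i (h ^+ l).
Proof.
move=> ih; elim: l => [|l IHl]; last by rewrite exprS; apply: avoidsM.
by move=> m; rewrite expr0 msupp1 inE => /eqP ->; rewrite mnm0E.
Qed.

Lemma avoidsXi n (i j : 'I_n) : i != j -> avoids i ('X_j : {mpoly k[n]}).
Proof.
by move=> ij m; rewrite msuppX inE => /eqP ->; rewrite mnm1E eq_sym (negbTE ij).
Qed.

Lemma mmap1_4 (R : comNzRingType) (u : 'I_4 -> R) (m : 'X_{1..4}) :
  mmap1 u m = u i0 ^+ m i0 * u i1 ^+ m i1 * u i2 ^+ m i2 * u i3 ^+ m i3.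
Proof.
rewrite /mmap1 !big_ord_recl big_ord0 mulr1 !mulrA.
by do !congr (_ * _); congr (u _ ^+ m _); apply: val_inj.
Qed.

Lemma mmap1_3 (R : comNzRingType) (u : 'I_3 -> R) (m : 'X_{1..3}) :
  mmap1 u m = u (@Ordinal 3 0 isT) ^+ m (@Ordinal 3 0 isT) *
              u (@Ordinal 3 1 isT) ^+ m (@Ordinal 3 1 isT) *
              u (@Ordinal 3 2 isT) ^+ m (@Ordinal 3 2 isT).
Proof.
rewrite /mmap1 !big_ord_recl big_ord0 mulr1 !mulrA.
by do !congr (_ * _); congr (u _ ^+ m _); apply: val_inj.
Qed.

Lemma eval_xyzwE h : eval_xyzw h = \sum_(m <- msupp h)
  h@_m *: (x ^+ m i0 * y ^+ m i1 * z ^+ m i2 * (y * z - x ^+ 6) ^+ m i3).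
Proof.
by rewrite /eval_xyzw /mmap; apply: eq_bigr => m _; rewrite mmap1_4 mul_mpolyC.
Qed.

Definition normal_form (h : {mpoly k[4]}) :=
  forall m, m \in msupp h -> (m i1 == 0)%N || (m i2 == 0)%N.

Lemma normal_form_exists r : exists2 h, normal_form h & r = eval_xyzw h.
Proof.
elim/mpolyind: r => [|c m r _ _ [h nh ->]].
  by exists 0; [move=> m; rewrite msupp0 | rewrite rmorph0].
suff [g ng ->] : exists2 g, normal_form g & 'X_[m] = eval_xyzw g.
  exists (c *: g + h); last by rewrite rmorphD /= -mul_mpolyC -mmapZ.
  move=> l /msuppD_le; rewrite mem_cat => /orP[/msuppZ_le|].
    exact: ng.
  exact: nh.
have ev0 : eval_xyzw 'X_i0 = x by rewrite /eval_xyzw mmapX mmap1U.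
have ev1 : eval_xyzw 'X_i1 = y by rewrite /eval_xyzw mmapX mmap1U.
have ev2 : eval_xyzw 'X_i2 = z by rewrite /eval_xyzw mmapX mmap1U.
have ev3 : eval_xyzw 'X_i3 = y * z - x ^+ 6 by rewrite /eval_xyzw mmapX mmap1U.
have yz : y * z - x ^+ 6 + x ^+ 6 = y * z by rewrite subrK.
rewrite -mmap1_id mmap1_3 -/x -/y -/z.
set a := m _; set b := m _; set c' := m _.
(* Replacing every factor [y z] by [w + x^6] leaves a power of [z] alone or of [y] alone. *)
have [bc|/ltnW cb] := leqP b c'.
  exists ('X_i0 ^+ a * ('X_i3 + 'X_i0 ^+ 6) ^+ b * 'X_i2 ^+ (c' - b)).
    move=> l lh; apply/orP; left; apply/eqP; move: l lh; rewrite -/(avoids _ _).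
    by do !(apply: avoidsM || apply: avoidsD || apply: avoidsX ||
            apply: avoidsXi).
  rewrite !(rmorphM, rmorphXn, rmorphD) /= ev0 ev2 ev3 yz exprMn.
  by rewrite -{1}(subnK bc) exprD; ring.
exists ('X_i0 ^+ a * ('X_i3 + 'X_i0 ^+ 6) ^+ c' * 'X_i1 ^+ (b - c')).
  move=> l lh; apply/orP; right; apply/eqP; move: l lh; rewrite -/(avoids _ _).
  by do !(apply: avoidsM || apply: avoidsD || apply: avoidsX ||
            apply: avoidsXi).
rewrite !(rmorphM, rmorphXn, rmorphD) /= ev0 ev1 ev3 yz exprMn.
by rewrite -{1}(subnK cb) exprD; ring.
Qed.

Lemma weight_bound p q e N h : (0 < q <= 6 * p)%N -> normal_form h ->
  @Xdvd {mpoly k[3]} {poly {poly k}} (weight_hom p q e) N (eval_xyzw h) ->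
  forall m, m \in msupp h -> (N <= weight p q e (m i0) (m i1) (m i2) (m i3))%N.
Proof.
move=> /andP[q_gt0 q_le] nh [g Eg] m0 m0h.
(* Strong induction on the exponent of [w]: terms with a smaller one may be assumed to have weight
   at least [N]. *)
have [n] := ubnP (m0 i3); elim: n m0 m0h => // n IHn m0 m0h m0n.
rewrite leqNgt; apply/negP => lt_N.
(* [lc] reads off the coefficient at the leading term of [m0], in [T], then [W], then [X]. *)
pose lc (P : {poly {poly {poly k}}}) :=
  ((P`_(weight p q e (m0 i0) (m0 i1) (m0 i2) (m0 i3)))`_(m0 i3))
    `_(m0 i0 + 6 * m0 i2).
have : lc (weight_hom p q e (eval_xyzw h)) = 0.
  by rewrite Eg /lc coefMXn lt_N !coef0.
rewrite eval_xyzwE rmorph_sum /lc /= !coef_sum => /eqP; apply/negP.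
rewrite (bigD1_seq m0) ?msupp_uniq //= big1_seq ?addr0 => [|m /andP[m_neq mh]].
  rewrite /weight_hom mmapZ -/(weight_hom p q e _) /= !coefCM.
  have [Q ->] := @weight_hom_monomial k p q e (m0 i0) (m0 i1) (m0 i2) (m0 i3)
    q_le.
  rewrite coefMXn ltnn subnn coefD coefC eqxx coefD coefZ coefCM coefXnM ltnSn.
  by rewrite coefXn eqxx addr0 mulr1 coefXn eqxx mulr1 -mcoeff_msupp.
rewrite /weight_hom mmapZ -/(weight_hom p q e _) /= !coefCM.
have [Q ->] := @weight_hom_monomial k p q e (m i0) (m i1) (m i2) (m i3) q_le.
rewrite coefMXn; case: ltnP => [|le_w]; first by rewrite !coef0 mulr0.
(* Here [m] weighs at most as much as [m0], hence less than [N], so the induction hypothesis forbids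
   a smaller exponent of [w]. *)
have le_d : (m0 i3 <= m i3)%N.
  rewrite leqNgt; apply/negP => lt_d.
  have wN := IHn m mh (leq_trans lt_d m0n).
  by have := leq_trans lt_N (leq_trans wN le_w); rewrite ltnn.
rewrite coefD coefD coefCM coefXnM ltnS le_d addr0 coefC.
(* A nonzero contribution requires equal weights and equal exponents of [W] and [X], which by
   [weight_inj] force [m = m0]. *)
have [w0|_] := eqVneq; last by rewrite !coef0 mulr0.
rewrite coefZ coefXn; have [Ed|_] := eqVneq; last by rewrite mulr0 coef0 mulr0.
rewrite mulr1 coefXn; have [Ea|_] := eqVneq; last by rewrite mulr0.
have Ew : weight p q e (m i0) (m i1) (m i2) (m i3) =
          weight p q e (m0 i0) (m0 i1) (m0 i2) (m0 i3) by lia.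
have [E0 E1 E2] : [/\ m i0 = m0 i0, m i1 = m0 i1 & m i2 = m0 i2].
  by apply: (weight_inj _ _ (nh _ mh) (nh _ m0h) _ Ew) => //; rewrite q_gt0.
case/eqP: m_neq; apply/mnmP => i.
have : i \in [:: i0; i1; i2; i3] by case: i => [[|[|[|[|]]]]].
by rewrite !inE => /or4P[] /eqP ->.
Qed.

End NormalForm.

(** * The three valuations applied to the powers of [I] *)

Theorem proposition5p2 (k : fieldType) :
  let x : {mpoly k[3]} := 'X_(@Ordinal 3 0 isT) in
  let y : {mpoly k[3]} := 'X_(@Ordinal 3 1 isT) in
  let z : {mpoly k[3]} := 'X_(@Ordinal 3 2 isT) in
  normal_ideal (ideal_gen (fun g : {mpoly k[3]} =>
    g \in [:: y * z - x ^+ 6; x ^+ 7; x ^+ 4 * y; x ^+ 2 * y ^+ 2;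
              x ^+ 3 * z; y ^+ 3; z ^+ 2])).
Proof.
move=> x y z s _ r; split; last exact/integral_closure_sub/ideal_pow_is_ideal.
set I := ideal_gen _ => Ir.
have [h nh Er] := normal_form_exists r.
(* The seven inequalities, in the order of the generators, say that each generator has order at
   least [c]. *)
have bound p q e c : (0 < q <= 6 * p)%N ->
    [&& c <= 6 * p + e, c <= 7 * p, c <= 4 * p + q, c <= 2 * p + 2 * q,
        c <= 9 * p - q, c <= 3 * q & c <= 12 * p - 2 * q]%N ->
    forall m, m \in msupp h -> (s * c <= weight p q e (m (@Ordinal 4 0 isT))
      (m (@Ordinal 4 1 isT)) (m (@Ordinal 4 2 isT)) (m (@Ordinal 4 3 isT)))%N.
  move=> q_bounds c_le; apply: weight_bound => //; rewrite -Er.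
  have q_le : (q <= 6 * p)%N by case/andP: q_bounds.
  apply: Xdvd_integral Ir; apply: Xdvd_pow.
  apply: ideal_gen_min; first exact: Xdvd_ideal.
  have Xx : @Xdvd {mpoly k[3]} {poly {poly k}} (weight_hom p q e) p x.
    by eexists; exact: weight_homx.
  have Xy : @Xdvd {mpoly k[3]} {poly {poly k}} (weight_hom p q e) q y.
    by exists 1; rewrite mul1r; exact: weight_homy.
  have Xz : @Xdvd {mpoly k[3]} {poly {poly k}} (weight_hom p q e) (6 * p - q) z.
    by eexists; exact: weight_homz.
  have Xw : @Xdvd {mpoly k[3]} {poly {poly k}} (weight_hom p q e)
               (6 * p + e) (y * z - x ^+ 6).
    by eexists; exact: weight_homw.
  case/and5P: c_le => c1 c2 c3 c4 /and3P[c5 c6 c7] g.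
  rewrite !inE => /orP[|/or4P[|||/or3P[]]] /eqP ->.
  - exact: Xdvd_le Xw.
  - by apply: Xdvd_le (XdvdX 7 Xx); lia.
  - by apply: Xdvd_le (XdvdM (XdvdX 4 Xx) Xy); lia.
  - by apply: Xdvd_le (XdvdM (XdvdX 2 Xx) (XdvdX 2 Xy)); lia.
  - by apply: Xdvd_le (XdvdM (XdvdX 3 Xx) Xz); lia.
  - by apply: Xdvd_le (XdvdX 3 Xy); lia.
  - by apply: Xdvd_le (XdvdX 2 Xz); lia.
have [I0 ID IM] := ideal_pow_is_ideal I s.
rewrite Er eval_xyzwE big_seq; apply: big_ind => // m mh.
rewrite -mul_mpolyC; apply: IM; apply: normal_monomial_mem; first exact: nh.
- by have := bound 1 2 0 6 isT isT m mh; rewrite /weight; lia.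
- by have := bound 1 3 0 6 isT isT m mh; rewrite /weight; lia.
- by have := bound 2 5 1 13 isT isT m mh; rewrite /weight; lia.
Qed.
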